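(* Let $\mathbf x_0=(x_0,y_0)\in\mathbb R^2$, let $d\in\mathbb N$ with $d\ge 2$, let $\omega\in\mathbb R$ with $\omega\neq 0$, let $\rho>0$, and let $c$ be a real-valued function of class $\mathcal C^{d-2}$ in a neighborhood of $\mathbf x_0$ with $c(\mathbf x_0)\neq 0$. Let $\mathbb S_d$ be the associated quasi-Trefftz space, and for $(p,v_x,v_y)\in\mathbb P^d\times(\mathbb P^{d-1})^2$ write $$p=\sum_{k=0}^{d}\sum_{\ell=0}^k\lambda^k_\ell (x-x_0)^\ell (y-y_0)^{k-\ell},\quad v_x=\sum_{k=0}^{d-1}\sum_{\ell=0}^k\mu^k_\ell (x-x_0)^\ell (y-y_0)^{k-\ell},\quad v_y=\sum_{k=0}^{d-1}\sum_{\ell=0}^k\eta^k_\ell (x-x_0)^\ell (y-y_0)^{k-\ell}.$$ Consider either one of the following two lists of $2d+1$ coefficients: (A) $\lambda^0_0,\ \mu^0_0,\ \eta^0_0$, and $\eta^k_0,\eta^k_1$ for $1\le k\le d-1$; (B) $\lambda^0_0$, and $\lambda^k_0,\lambda^k_1$ for $1\le k\le d$. Then for each of the two lists: (i) for every choice of $2d+1$ complex values there exists an element $(p,v_x,v_y)\in\mathbb S_d$ whose coefficients in the list take these prescribed values; (ii) if $2d+1$ elements of $\mathbb S_d$ are such that their vectors of coefficients in the list form a basis of $\mathbb C^{2d+1}$, then these elements are linearly independent. Moreover $\dim_{\mathbb C}\mathbb S_d=2d+1$, so that any $2d+1$ elements as in (ii) form a basis of $\mathbb S_d$.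
   Context: $\mathbb P^k$ denotes the space of polynomials in two variables $(x,y)$ with complex coefficients of total degree at most $k$. For a function $f$ of class $\mathcal C^q$ in a neighborhood of $\mathbf x_0$, $\mathcal T_q f$ denotes its Taylor polynomial of degree $q$ centered at $\mathbf x_0$. Define the differential operators (with $\mathrm i$ the imaginary unit) $$\mathcal S_1(p,v_x,v_y)=-\mathrm i\omega\rho v_x+\partial_x p,\quad \mathcal S_2(p,v_x,v_y)=-\mathrm i\omega\rho v_y+\partial_y p,\quad \mathcal S_3(p,v_x,v_y)=-\frac{\mathrm i\omega}{\rho c^2}p+\partial_x v_x+\partial_y v_y.$$ The quasi-Trefftz space is $$\mathbb S_d=\left\{(p,v_x,v_y)\in\mathbb P^d\times(\mathbb P^{d-1})^2\ :\ \mathcal T_{d-1}(\mathcal S_1(p,v_x,v_y))=0,\ \mathcal T_{d-1}(\mathcal S_2(p,v_x,v_y))=0,\ \mathcal T_{d-2}(\mathcal S_3(p,v_x,v_y))=0\right\}.$$ *)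

(* Defs.v *)
From HB Require Import structures.
From mathcomp Require Import all_boot all_order all_algebra.
From mathcomp Require Import complex.
From mathcomp Require Import classical_sets reals topology normedtype derive.
(* The notations of mpoly clash with those of MathComp-Analysis. *)
From mathcomp Require mpoly.
Import -(notations) mpoly.

Set Implicit Arguments.
Unset Strict Implicit.
Unset Printing Implicit Defensive.

Import Order.TTheory GRing.Theory Num.Theory numFieldNormedType.Exports.

Local Open Scope ring_scope.

Notation "'{poly2' F }" := (mpoly 2 F) (format "'{poly2'  F }") : type_scope.

Definition varX (F : nzRingType) : {poly2 F} := mpolyX F (mnm1 0).
Definition varY (F : nzRingType) : {poly2 F} := mpolyX F (mnm1 1).

(* [msize p] is the total degree of [p] plus one, and [msize 0 = 0]. *)
Definition tdeg_le (F : nzRingType) (k : nat) : {pred {poly2 F}} :=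
  fun p => (msize p <= k.+1)%N.

Section TotalDegree.
Variables (F : nzRingType) (k : nat).

Lemma tdeg_le_submod : submod_closed (@tdeg_le F k).
Proof.
split=> [|a p q]; rewrite !unfold_in; first by rewrite mmeasure0.
move=> hp hq; apply: leq_trans (mmeasureD_le _ _ _) _.
by rewrite geq_max hq andbT (leq_trans (mmeasureZ_le _ _ _) hp).
Qed.

HB.instance Definition _ :=
  GRing.isSubmodClosed.Build F {poly2 F} (@tdeg_le F k) tdeg_le_submod.

Record bpoly := BPoly { bpoly_val :> {poly2 F}; _ : bpoly_val \in @tdeg_le F k }.

HB.instance Definition _ := [isSub for bpoly_val].
HB.instance Definition _ := [Choice of bpoly by <:].
HB.instance Definition _ := [SubChoice_isSubLmodule of bpoly by <:].

Lemma bpoly_vect_axiom : Vector.axiom #|{: bmultinom 2 k.+1}| bpoly.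
Proof.
pose M (i : 'I_#|{: bmultinom 2 k.+1}|) : bmultinom 2 k.+1 := enum_val i.
exists (fun p : bpoly => \row_i mcoeff (M i) (val p)) => [a p q|].
  by apply/rowP => i; rewrite !mxE mcoeffD mcoeffZ.
pose g (r : 'rV[F]_#|{: bmultinom 2 k.+1}|) : {poly2 F} :=
  \sum_(m : bmultinom 2 k.+1) r 0 (enum_rank m) *: mpolyX F m.
have dg r : g r \in @tdeg_le F k.
  rewrite rpred_sum // => m _; apply: rpredZ.
  by rewrite unfold_in mmeasureX bmdeg.
exists (fun r => BPoly (dg r)) => [p|r]; last first.
  apply/rowP => i; rewrite mxE /= raddf_sum (bigD1 (M i)) //= big1.
    by rewrite addr0 mcoeffZ mcoeffX eqxx mulr1 enum_valK.
  by move=> m ne; rewrite mcoeffZ mcoeffX -bmeqP (negbTE ne) mulr0.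
apply: val_inj => /=; have hp : (msize (val p) <= k.+1)%N by case: p.
rewrite [RHS](mpolywE hp); apply: eq_bigr => m _.
by rewrite mxE /M enum_rankK.
Qed.

HB.instance Definition _ := Lmodule_hasFinDim.Build F bpoly bpoly_vect_axiom.

End TotalDegree.

Section QuasiTrefftz.
Variable R : realType.
Local Notation C := R[i].
Local Open Scope complex_scope.

Definition ex : R * R := (1, 0).
Definition ey : R * R := (0, 1).

(* Partial derivatives of complex-valued functions of two real variables are
   taken separately on the real and the imaginary parts. *)
Definition partial (v : R * R) (f : R * R -> C) (z : R * R) : C :=
  ('D_v (fun w => complex.Re (f w)) z) +i* ('D_v (fun w => complex.Im (f w)) z).

Definition dx := partial ex.
Definition dy := partial ey.

(* Class C^q on [U], for [U] open: all iterated partial derivatives of order at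
   most [q], in every order of differentiation, exist and are continuous. *)
Fixpoint class_C (q : nat) (U : set (R * R)) (f : R * R -> R) : Prop :=
  (forall z, U z -> {for z, continuous f}) /\
  match q with
  | 0 => True
  | q'.+1 =>
      [/\ forall z, U z -> derivable f z ex,
          forall z, U z -> derivable f z ey,
          class_C q' U (fun z => 'D_ex f z) &
          class_C q' U (fun z => 'D_ey f z)]
  end.

Definition class_C_near (q : nat) (f : R * R -> R) (z0 : R * R) : Prop :=
  exists2 U : set (R * R), open_nbhs z0 U & class_C q U f.

Definition peval (p : {poly2 C}) (z : R * R) : C :=
  meval (fun j : 'I_2 => if j == 0 then z.1%:C else z.2%:C) p.

(* (x - x0)^l (y - y0)^m *)
Definition cmonom (z0 : R * R) (l m : nat) : {poly2 C} :=
  (varX C - mpolyC 2 z0.1%:C) ^+ l * (varY C - mpolyC 2 z0.2%:C) ^+ m.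

Definition taylor (q : nat) (f : R * R -> C) (z0 : R * R) : {poly2 C} :=
  \sum_(k < q.+1) \sum_(l < k.+1)
    (iter l dx (iter (k - l) dy f) z0 / (l`! * (k - l)`!)%:R)
      *: cmonom z0 l (k - l).

(* The coefficient of (x - x0)^l (y - y0)^(k - l) in [p], i.e. the coefficient
   of x^l y^(k - l) in p(x + x0, y + y0); see [ccoef_expansion]. *)
Definition ccoef (z0 : R * R) (p : {poly2 C}) (k l : nat) : C :=
  mcoeff (Multinom [tuple l; (k - l)%N])
    (comp_mpoly [tuple varX C + mpolyC 2 z0.1%:C;
                       varY C + mpolyC 2 z0.2%:C] p).

Lemma ccoef_expansion (z0 : R * R) (k : nat) (p : bpoly C k) :
  bpoly_val p =
  \sum_(j < k.+1) \sum_(l < j.+1) ccoef z0 p j l *: cmonom z0 l (j - l).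
Proof.
pose a := z0.1%:C; pose b := z0.2%:C.
pose T := [tuple varX C + mpolyC 2 a; varY C + mpolyC 2 b].
pose T' := [tuple varX C - mpolyC 2 a; varY C - mpolyC 2 b].
have degM (r s : {poly2 C}) i j : (msize r <= i.+1)%N -> (msize s <= j.+1)%N ->
    (msize (r * s) <= (i + j).+1)%N.
  have [->|r0] := eqVneq r 0; first by rewrite mul0r mmeasure0.
  have [->|s0] := eqVneq s 0; first by rewrite mulr0 mmeasure0.
  rewrite msizeM // => hr hs; rewrite -ltnS prednK; last first.
    by rewrite addn_gt0 lt0n msize_poly_eq0 r0.
  by rewrite (leq_trans (leq_add hr hs)) // addSn addnS.
have degX (r : {poly2 C}) i : (msize r <= 2)%N -> (msize (r ^+ i) <= i.+1)%N.
  move=> hr; elim: i => [|i IH]; first by rewrite expr0 mmeasure1.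
  by rewrite exprS; exact: (degM _ _ 1%N i hr IH).
have degT (i : 'I_2) : (msize (tnth T i) <= 2)%N.
  have h (j : 'I_2) (e : C) : (msize (mpolyX C (mnm1 j) + mpolyC 2 e) <= 2)%N.
    rewrite (leq_trans (mmeasureD_le _ _ _)) // geq_max msizeX mdeg1 /=.
    by rewrite mmeasureC; case: (e != 0).
  by case: i => [[|[|//]] i]; rewrite (tnth_nth 0) /=; apply: h.
pose q := comp_mpoly T (bpoly_val p).
have degq : (msize q <= k.+1)%N.
  have hp : (msize (bpoly_val p) <= k.+1)%N by case: (p).
  rewrite /q (comp_mpolywE _ hp).
  apply: (@rpred_sum _ (@tdeg_le C k)) => m _; apply: rpredZ.
  rewrite unfold_in (leq_trans _ (_ : mdeg m < k.+1)%N) ?bmdeg //.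
  rewrite mdegE !big_ord_recl !big_ord0 mulr1 addn0.
  by apply: degM; apply: degX; apply: degT.
have pE : bpoly_val p = comp_mpoly T' q.
  rewrite [q]comp_mpolyEX raddf_sum /= [LHS]mpolyE; apply: eq_bigr => m _.
  rewrite linearZ /=; congr (_ *: _).
  rewrite comp_mpolyX rmorph_prod mpolyXE_id; apply: eq_bigr => i _.
  rewrite rmorphXn; congr (_ ^+ _).
  case: i => [[|[|//]] i]; rewrite (tnth_nth 0) /= rmorphD /= comp_mpolyC.
    rewrite /varX comp_mpolyXU /= subrK; congr (mpolyX _ (mnm1 _)); exact: val_inj.
  rewrite /varY comp_mpolyXU /= subrK; congr (mpolyX _ (mnm1 _)); exact: val_inj.
have cE j l : ccoef z0 p j l = mcoeff (Multinom [tuple l; (j - l)%N]) q by [].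
clearbody q.
pose mn l n : multinom 2 := Multinom [tuple l; n].
have mn_deg l n : mdeg (mn l n) = (l + n)%N.
  by rewrite mdegE !big_ord_recl big_ord0 addn0.
have mnE (m : multinom 2) : m = mn (m ord0) (mdeg m - m ord0)%N.
  apply/mnmP => i; rewrite mdegE !big_ord_recl big_ord0 addn0 addKn.
  by case: i => [[|[|//]] i]; rewrite [RHS](mnm_nth 0) /=; congr (m _); exact: val_inj.
have qE : q = \sum_(j < k.+1) \sum_(l < j.+1)
    mcoeff (mn l (j - l)%N) q *: mpolyX C (mn l (j - l)%N).
  apply/mpolyP => m; rewrite (raddf_sum (mcoeff m)).
  have other (j : 'I_k.+1) (l : 'I_j.+1) : mn l (j - l)%N != m ->
      mcoeff m (mcoeff (mn l (j - l)%N) q *: mpolyX C (mn l (j - l)%N)) = 0.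
    by rewrite mcoeffZ mcoeffX => /negbTE ->; rewrite mulr0.
  have [mk|mk] := ltnP (mdeg m) k.+1; last first.
    rewrite big1 => [|j _]; first by apply/memN_msupp_eq0/msize_mdeg_ge/(leq_trans degq).
    rewrite raddf_sum big1 // => l _; apply: other; apply: contraTneq mk => <-.
    by rewrite mn_deg subnKC -?ltnNge // -ltnS.
  have m0 : (m ord0 < (mdeg m).+1)%N by rewrite ltnS mdegE (bigD1 ord0) //= leq_addr.
  rewrite (bigD1 (Ordinal mk)) //= [X in _ + X]big1 ?addr0; last first.
    move=> j ne; rewrite raddf_sum big1 // => l _; apply: other.
    apply: contraNneq ne => e; apply/eqP/val_inj; rewrite /= -e mn_deg subnKC //.
    by rewrite -ltnS.
  rewrite raddf_sum (bigD1 (Ordinal m0)) //= [X in _ + X]big1 ?addr0; last first.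
    move=> l ne; apply: (other (Ordinal mk)); apply: contraNneq ne => e.
    by apply/eqP/val_inj; move/mnmP: e => /(_ ord0).
  by rewrite -mnE mcoeffZ mcoeffX eqxx mulr1.
rewrite [LHS]pE {1}qE (raddf_sum (comp_mpoly T')); apply: eq_bigr => j _.
rewrite (raddf_sum (comp_mpoly T')); apply: eq_bigr => l _; rewrite cE.
transitivity (mcoeff (mn l (j - l)%N) q *: comp_mpoly T' (mpolyX C (mn l (j - l)%N))).
  exact: comp_mpolyZ.
congr (_ *: _).
by rewrite comp_mpolyX !big_ord_recl big_ord0 mulr1.
Qed.

Section Operators.
Variables (omega rho : R) (c : R * R -> R).
Implicit Types p vx vy : R * R -> C.

Definition S1 p vx vy z : C := - ('i * (omega * rho)%:C) * vx z + dx p z.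
Definition S2 p vx vy z : C := - ('i * (omega * rho)%:C) * vy z + dy p z.
Definition S3 p vx vy z : C :=
  - ('i * (omega / (rho * c z ^+ 2))%:C) * p z + dx vx z + dy vy z.

End Operators.

Definition triple (d : nat) : vectType C :=
  (bpoly C d * bpoly C (d - 1) * bpoly C (d - 1))%type.

Definition quasi_trefftz (d : nat) (omega rho : R) (c : R * R -> R)
    (z0 : R * R) : set (triple d) :=
  [set u : triple d | let: (p, vx, vy) := u in
    [/\ taylor (d - 1) (S1 omega rho (peval p) (peval vx) (peval vy)) z0 = 0,
        taylor (d - 1) (S2 omega rho (peval p) (peval vx) (peval vy)) z0 = 0 &
        taylor (d - 2) (S3 omega rho c (peval p) (peval vx) (peval vy)) z0 = 0]].

Inductive coef_list := ListA | ListB.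

Definition coefs (L : coef_list) (d : nat) (z0 : R * R) (u : triple d) : seq C :=
  let: (p, vx, vy) := u in
  match L with
  | ListA =>
      [:: ccoef z0 p 0 0, ccoef z0 vx 0 0, ccoef z0 vy 0 0 &
          flatten [seq [:: ccoef z0 vy k 0; ccoef z0 vy k 1] | k <- iota 1 (d - 1)]]
  | ListB =>
      ccoef z0 p 0 0 ::
        flatten [seq [:: ccoef z0 p k 0; ccoef z0 p k 1] | k <- iota 1 d]
  end.

Lemma size_coefs L d z0 (u : triple d) :
  (0 < d)%N -> size (coefs L z0 u) = (2 * d + 1)%N.
Proof.
have sz (T : Type) (f g : nat -> T) s :
    size (flatten [seq [:: f k; g k] | k <- s]) = (2 * size s)%N.
  by elim: s => //= k s ->; rewrite mulnS.
case: u => [[p vx] vy] d0; case: L => /=; rewrite sz size_iota //.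
  by rewrite addn1; case: d d0 {p vx vy} => // d _; rewrite subn1 mulnS.
by rewrite addn1.
Qed.

Definition coef_vec (L : coef_list) (d : nat) (z0 : R * R) (u : triple d) :
    'rV[C]_(2 * d + 1) :=
  \row_i (coefs L z0 u)`_i.

End QuasiTrefftz.

(* Main.v *)
Require Import Defs.
From HB Require Import structures.
From mathcomp Require Import all_boot all_order all_algebra.
From mathcomp Require Import complex.
From mathcomp Require Import boolp classical_sets functions.
From mathcomp Require Import reals topology normedtype derive.
From mathcomp Require Import ring.
From mathcomp Require mpoly.
Import -(notations) mpoly.

Set Implicit Arguments.
Unset Strict Implicit.
Unset Printing Implicit Defensive.

Import Order.TTheory GRing.Theory Num.Theory numFieldNormedType.Exports.

Local Open Scope classical_set_scope.
Local Open Scope ring_scope.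

(** The Taylor conditions are finitely many linear equations, so the
    quasi-Trefftz space is the kernel of a linear map into a space of row
    vectors, and counting monomials with rank-nullity gives dimension at least
    [2 d + 1].  It remains to see that an element whose listed coefficients
    vanish is zero.  The first two conditions express the coefficients of the
    velocity through those of the pressure, which reduces list (A) to list (B).
    The third then reads, at the index [(l, m)],
    [(l+2)(l+1) lambda_(l+2,m) + (m+2)(m+1) lambda_(l,m+2)] = a linear
    combination of the [lambda_(i,j)] with [i + j <= l + m], because a
    derivative of order [l + m] of the product of a smooth function with a
    centered monomial of larger degree vanishes at the center.  Hence all the
    [lambda]'s vanish, by induction on the total degree and then on the exponent
    of [x]. *)

(** * Functions of class C^q *)

Section ClassC.
Variable R : realType.
Implicit Types (U : set (R * R)) (f g : R * R -> R) (b : bool).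

(** With directions encoded as booleans, one argument serves both partial derivatives, and iterated
    derivatives become words in [seq bool]. *)
Definition dir b : R * R := if b then ex R else ey R.

Lemma class_C_cont q U f : class_C q U f -> forall z, U z -> {for z, continuous f}.
Proof. by case: q => [|q] []. Qed.

Lemma class_CSP q U f : class_C q.+1 U f <->
  [/\ forall z, U z -> {for z, continuous f},
      forall b z, U z -> derivable f z (dir b) &
      forall b, class_C q U (fun z => 'D_(dir b) f z)].
Proof.
split=> [[cf [dfx dfy Cx Cy]]|[cf df Cf]].
  by split; [exact: cf | case; [exact: dfx|exact: dfy] | case; [exact: Cx|exact: Cy]].
by split=> //; split; [exact: (df true)|exact: (df false)|exact: (Cf true)|exact: (Cf false)].
Qed.

Lemma class_C_pred q U f : class_C q.+1 U f -> class_C q U f.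
Proof.
elim: q f => [|q IH] f /class_CSP [cf df Cf]; first by split.
by apply/class_CSP; split=> // b; apply: IH.
Qed.

Lemma class_C_le q q' U f : (q' <= q)%N -> class_C q U f -> class_C q' U f.
Proof.
move=> /subnK <-; elim: (q - q')%N => [//|n IH] Cf.
by apply: IH; apply: class_C_pred.
Qed.

Lemma open_near_eq U f g z : open U -> U z -> (forall w, U w -> f w = g w) ->
  \near z, f z = g z.
Proof. by move=> oU Uz fg; apply: filterS fg _; apply: open_nbhs_nbhs. Qed.

(** Since [U] is open, [f] and [g] agree near each of its points, and limits and derivatives see
    nothing else. The differentiation rules below hold only on [U], so classes are transported along
    this equality. *)
Lemma class_C_ext q U f g : open U -> (forall z, U z -> f z = g z) ->
  class_C q U f -> class_C q U g.
Proof.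
move=> oU; elim: q f g => [|q IH] f g fg.
  move=> [cf _]; split=> // z Uz; rewrite /prop_for /continuous_at -(fg z Uz).
  by apply: cvg_trans (cf z Uz); apply: near_eq_cvg; apply: (open_near_eq oU).
move=> /class_CSP [cf df Cf]; apply/class_CSP; split.
- move=> z Uz; rewrite /prop_for /continuous_at -(fg z Uz).
  by apply: cvg_trans (cf z Uz); apply: near_eq_cvg; apply: (open_near_eq oU).
- move=> b z Uz; apply: near_eq_derivable (df b z Uz).
  exact: (open_near_eq oU).
- move=> b; apply: IH (Cf b) => z Uz; apply: near_eq_derive.
  exact: (open_near_eq oU).
Qed.

Lemma class_C_sub q U U' f : (forall z, U' z -> U z) -> class_C q U f ->
  class_C q U' f.
Proof.
move=> sU; elim: q f => [|q IH] f; first by move=> [cf _]; split=> // z /sU; apply: cf.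
move=> /class_CSP [cf df Cf]; apply/class_CSP.
by split=> [z /sU||b]; [apply: cf|move=> b z /sU; apply: df|apply: IH].
Qed.

Lemma class_C_cst q U (a : R) : class_C q U (cst a).
Proof.
elim: q a => [|q IH] a; first by split=> // z _; apply: cst_continuous.
apply/class_CSP; split=> [z _|b z _|b]; [exact: cst_continuous|exact: derivable_cst|].
rewrite (_ : (fun z => _) = cst 0) //; apply/funext => z; exact: derive_cst.
Qed.

Lemma class_CD q U f g : open U -> class_C q U f -> class_C q U g ->
  class_C q U (f + g).
Proof.
move=> oU; elim: q f g => [|q IH] f g.
  by move=> [cf _] [cg _]; split=> // z Uz; apply: continuousD; [apply: cf|apply: cg].
move=> /class_CSP [cf df Cf] /class_CSP [cg dg Cg]; apply/class_CSP; split.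
- by move=> z Uz; apply: continuousD; [apply: cf|apply: cg].
- by move=> b z Uz; apply: derivableD; [apply: df|apply: dg].
- move=> b; apply: (class_C_ext oU _ (IH _ _ (Cf b) (Cg b))) => z Uz.
  by rewrite deriveD //; [apply: df|apply: dg].
Qed.

(** The Leibniz rule pairs each function with a derivative of the other; the undifferentiated factor
    is lowered to order [q] by [class_C_pred], and the induction hypothesis applies. *)
Lemma class_CM q U f g : open U -> class_C q U f -> class_C q U g ->
  class_C q U (f * g).
Proof.
move=> oU; elim: q f g => [|q IH] f g.
  by move=> [cf _] [cg _]; split=> // z Uz; apply: continuousM; [apply: cf|apply: cg].
move=> Cf' Cg'; have := Cf'; have := Cg'.
move=> /class_CSP [cg dg Cg] /class_CSP [cf df Cf]; apply/class_CSP; split.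
- by move=> z Uz; apply: continuousM; [apply: cf|apply: cg].
- by move=> b z Uz; apply: derivableM; [apply: df|apply: dg].
- move=> b; have := class_CD oU (IH _ _ (class_C_pred Cf') (Cg b))
                                (IH _ _ (class_C_pred Cg') (Cf b)).
  apply: class_C_ext oU _ => z Uz.
  by rewrite deriveM //; [apply: df|apply: dg].
Qed.

Lemma class_CN q U f : open U -> class_C q U f -> class_C q U (- f).
Proof.
move=> oU Cf; have := class_CM oU (class_C_cst q U (-1)) Cf.
by apply: class_C_ext => // z _; rewrite -[LHS]/(-1 * f z) mulN1r.
Qed.

(** The derivative is $-(1/f)(1/f)\,\partial f$, where $1/f$ is already of class $C^q$ by induction;
    only products remain. *)
Lemma class_CV q U f : open U -> (forall z, U z -> f z != 0) ->
  class_C q U f -> class_C q U (fun z => (f z)^-1).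
Proof.
move=> oU f0; elim: q => [|q IH].
  by move=> [cf _]; split=> // z Uz; apply: cvgV; [apply: f0|apply: cf].
move=> Cf'; have := Cf' => /class_CSP [cf df Cf]; apply/class_CSP; split.
- by move=> z Uz; apply: cvgV; [apply: f0|apply: cf].
- by move=> b z Uz; apply: derivableV; [apply: f0|apply: df].
- move=> b; have CV := IH (class_C_pred Cf').
  have := class_CN oU (class_CM oU (class_CM oU CV CV) (Cf b)).
  apply: class_C_ext => // z Uz; rewrite deriveV; [|exact: f0|exact: df].
  by rewrite scaleNr -exprVn expr2.
Qed.

(** The difference quotient equals [a] for every nonzero [h]. This serves the coordinate
    functions. *)
Lemma is_derive_affine f (v z : R * R) (a : R) :
  (forall h, f (h *: v + z) = h * a + f z) -> is_derive z v f a.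
Proof.
move=> fE.
have cv : (fun h : R => h^-1 *: ((f \o shift z) (h *: v) - f z)) @ 0^' --> a.
  apply: cvg_near_cst; near=> h; rewrite /= fE addrK.
  by rewrite scalerA mulVf ?scale1r //; near: h; exact: nbhs_dnbhs_neq.
apply: DeriveDef; last exact: cvg_lim cv.
by apply/cvg_ex; exists a.
Unshelve. all: by end_near. Qed.

Lemma class_C_fst q U : class_C q U fst.
Proof.
have D b z : is_derive z (dir b) (fst : R * R -> R) (dir b).1.
  exact: is_derive_affine.
case: q => [|q]; first by split; [move=> z _; exact: cvg_fst|exact: I].
apply/class_CSP; split=> [z _|b z _|b]; [exact: cvg_fst|exact: ex_derive|].
rewrite (_ : (fun z => _) = cst (dir b).1); first exact: class_C_cst.
by apply/funext => z; rewrite derive_val.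
Qed.

Lemma class_C_snd q U : class_C q U snd.
Proof.
have D b z : is_derive z (dir b) (snd : R * R -> R) (dir b).2.
  exact: is_derive_affine.
case: q => [|q]; first by split; [move=> z _; exact: cvg_snd|exact: I].
apply/class_CSP; split=> [z _|b z _|b]; [exact: cvg_snd|exact: ex_derive|].
rewrite (_ : (fun z => _) = cst (dir b).2); first exact: class_C_cst.
by apply/funext => z; rewrite derive_val.
Qed.

End ClassC.

(** * Complex-valued functions and their iterated partial derivatives *)

Section ComplexClassC.
Variable R : realType.
Local Notation C := R[i].
Local Open Scope complex_scope.
Implicit Types (U : set (R * R)) (f g : R * R -> C) (b : bool).

Definition cclass q U f :=
  class_C q U (fun z => complex.Re (f z)) /\ class_C q U (fun z => complex.Im (f z)).

Lemma cclass_ext q U f g : open U -> (forall z, U z -> f z = g z) ->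
  cclass q U f -> cclass q U g.
Proof.
by move=> oU fg [Rf If]; split; [apply: class_C_ext Rf|apply: class_C_ext If] => // z Uz;
  rewrite fg.
Qed.

Lemma cclass_le q q' U f : (q' <= q)%N -> cclass q U f -> cclass q' U f.
Proof. by move=> qq [Rf If]; split; apply: class_C_le qq _. Qed.

Lemma cclass_cst q U (a : C) : cclass q U (fun=> a).
Proof. by split; apply: class_C_cst. Qed.

Lemma cclass_real q U (f : R * R -> R) : class_C q U f -> cclass q U (fun z => (f z)%:C).
Proof. by move=> Cf; split=> //; apply: class_C_cst. Qed.

Lemma ReD (x y : C) : complex.Re (x + y) = complex.Re x + complex.Re y.
Proof. by case: x y => [? ?] []. Qed.

Lemma ImD (x y : C) : complex.Im (x + y) = complex.Im x + complex.Im y.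
Proof. by case: x y => [? ?] []. Qed.

Lemma ReM (x y : C) : complex.Re (x * y) =
  complex.Re x * complex.Re y - complex.Im x * complex.Im y.
Proof. by case: x y => [? ?] []. Qed.

Lemma ImM (x y : C) : complex.Im (x * y) =
  complex.Re x * complex.Im y + complex.Im x * complex.Re y.
Proof. by case: x y => [? ?] []. Qed.

Lemma cclassD q U f g : open U -> cclass q U f -> cclass q U g ->
  cclass q U (fun z => f z + g z).
Proof.
move=> oU [Rf If] [Rg Ig]; split.
  by apply: class_C_ext oU _ (class_CD oU Rf Rg) => z _; rewrite ReD.
by apply: class_C_ext oU _ (class_CD oU If Ig) => z _; rewrite ImD.
Qed.

Lemma cclassM q U f g : open U -> cclass q U f -> cclass q U g ->
  cclass q U (fun z => f z * g z).
Proof.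
move=> oU [Rf If] [Rg Ig]; split.
  apply: class_C_ext oU _
    (class_CD oU (class_CM oU Rf Rg) (class_CN oU (class_CM oU If Ig))) => z _.
  by rewrite ReM.
apply: class_C_ext oU _ (class_CD oU (class_CM oU Rf Ig) (class_CM oU If Rg)) => z _.
by rewrite ImM.
Qed.

Lemma cclass_sum q U (I : Type) (s : seq I) (F : I -> R * R -> C) : open U ->
  (forall i, cclass q U (F i)) -> cclass q U (fun z => \sum_(i <- s) F i z).
Proof.
move=> oU CF; elim: s => [|i s IH].
  by apply: cclass_ext oU _ (cclass_cst q U 0) => z _; rewrite big_nil.
by apply: cclass_ext oU _ (cclassD oU (CF i) IH) => z _; rewrite big_cons.
Qed.

Lemma partial_ext v U f g : open U -> (forall z, U z -> f z = g z) ->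
  forall z, U z -> partial v f z = partial v g z.
Proof.
move=> oU fg z Uz; rewrite /partial; congr Complex; apply: near_eq_derive;
by apply: open_near_eq oU Uz _ => w Uw; rewrite fg.
Qed.

Lemma cclass_partial q U f b : cclass q.+1 U f -> cclass q U (partial (dir R b) f).
Proof. by move=> [/class_CSP[_ _ Rf] /class_CSP[_ _ If]]; split; [apply: Rf|apply: If]. Qed.

Lemma cclass_derivable q U f b z : cclass q.+1 U f -> U z ->
  derivable (fun z => complex.Re (f z)) z (dir R b) /\
  derivable (fun z => complex.Im (f z)) z (dir R b).
Proof. by move=> [/class_CSP[_ Rf _] /class_CSP[_ If _]] Uz; split; [apply: Rf|apply: If]. Qed.

Lemma partial_cst v (a : C) z : partial v (fun=> a) z = 0.
Proof. by rewrite /partial !derive_cst. Qed.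

Lemma partialD q U f g b z : cclass q.+1 U f -> cclass q.+1 U g -> U z ->
  partial (dir R b) (fun z => f z + g z) z = partial (dir R b) f z + partial (dir R b) g z.
Proof.
move=> Cf Cg Uz; have [Rf If] := cclass_derivable b Cf Uz.
have [Rg Ig] := cclass_derivable b Cg Uz.
rewrite /partial -[RHS]/(Complex _ _); congr Complex.
  by under eq_fun do rewrite ReD; rewrite -deriveD.
by under eq_fun do rewrite ImD; rewrite -deriveD.
Qed.

(** The real Leibniz rule is applied to the four products of real and imaginary parts, whose
    derivability comes from the class hypotheses. *)
Lemma partialM q U f g b z : cclass q.+1 U f -> cclass q.+1 U g -> U z ->
  partial (dir R b) (fun z => f z * g z) z =
  partial (dir R b) f z * g z + f z * partial (dir R b) g z.
Proof.
move=> Cf Cg Uz; have [Rf If] := cclass_derivable b Cf Uz.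
have [Rg Ig] := cclass_derivable b Cg Uz.
rewrite /partial.
have -> : (fun w => complex.Re (f w * g w)) =
    (fun w => complex.Re (f w)) * (fun w => complex.Re (g w)) -
    (fun w => complex.Im (f w)) * (fun w => complex.Im (g w)).
  by apply/funext => w; rewrite ReM.
have -> : (fun w => complex.Im (f w * g w)) =
    (fun w => complex.Re (f w)) * (fun w => complex.Im (g w)) +
    (fun w => complex.Im (f w)) * (fun w => complex.Re (g w)).
  by apply/funext => w; rewrite ImM.
rewrite (deriveB (derivableM Rf Rg) (derivableM If Ig)).
rewrite (deriveD (derivableM Rf Ig) (derivableM If Rg)).
rewrite (deriveM Rf Rg) (deriveM If Ig) (deriveM Rf Ig) (deriveM If Rg).
case: (f z) (g z) => [fr fi] [gr gi] /=.
rewrite /GRing.scale /=.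
move: ('D_(dir R b) _ z) ('D_(dir R b) _ z) ('D_(dir R b) _ z) ('D_(dir R b) _ z) => a1 a2 a3 a4.
by congr Complex; rewrite /=; ring.
Qed.

(* The head of [w] is the innermost derivative. *)
Definition Dw (w : seq bool) f := foldl (fun f b => partial (dir R b) f) f w.

(** The $y$-derivatives act first, hence stand at the front of the word. *)
Lemma Dw_iter l m f : iter l (@dx R) (iter m (@dy R) f) = Dw (nseq m false ++ nseq l true) f.
Proof.
have it b n h : iter n (partial (dir R b)) h = Dw (nseq n b) h.
  by elim: n h => //= n IH h; rewrite -IH -iterSr.
by rewrite /Dw foldl_cat -/(Dw _ _) -/(Dw _ _) -!it.
Qed.

Lemma Dw_ext w U f g : open U -> (forall z, U z -> f z = g z) ->
  forall z, U z -> Dw w f z = Dw w g z.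
Proof.
by move=> oU; elim: w f g => [|b w IH] f g fg //=; apply: IH; apply: partial_ext.
Qed.

(** Each letter uses up one order of regularity, so class $C^n$ suffices for words of length $n$. *)
Lemma DwD w U f g z : open U -> cclass (size w) U f -> cclass (size w) U g -> U z ->
  Dw w (fun z => f z + g z) z = Dw w f z + Dw w g z.
Proof.
move=> oU; elim: w f g => [|b w IH] f g //= Cf Cg Uz.
rewrite -IH //; try exact: cclass_partial.
by apply: (Dw_ext w oU) Uz => y Uy; exact: (partialD _ Cf Cg Uy).
Qed.

Lemma DwZ w U (a : C) f z : open U -> cclass (size w) U f -> U z ->
  Dw w (fun z => a * f z) z = a * Dw w f z.
Proof.
move=> oU; elim: w f => [|b w IH] f //= Cf Uz.
rewrite -IH //; last exact: cclass_partial.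
apply: (Dw_ext w oU) Uz => y Uy.
by rewrite (partialM _ (cclass_cst _ _ a) Cf) // partial_cst mul0r add0r.
Qed.

Lemma Dw0 w z : Dw w (fun=> 0) z = 0.
Proof.
elim: w => //= b w IH; rewrite -[RHS]IH; congr (Dw w _ z).
by apply/funext => y; rewrite partial_cst.
Qed.

Lemma Dw_sum w U (I : Type) (s : seq I) (F : I -> R * R -> C) z : open U ->
  (forall i, cclass (size w) U (F i)) -> U z ->
  Dw w (fun z => \sum_(i <- s) F i z) z = \sum_(i <- s) Dw w (F i) z.
Proof.
move=> oU CF Uz; elim: s => [|i s IH].
  by under eq_fun do rewrite big_nil; rewrite Dw0 big_nil.
rewrite big_cons -IH -(DwD oU) //; last exact: cclass_sum.
by under eq_fun do rewrite big_cons.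
Qed.

End ComplexClassC.

(** * Polynomial functions *)

Section PolynomialFunctions.
Variable R : realType.
Local Notation C := R[i].
Local Open Scope complex_scope.
Implicit Types (p q : {poly2 C}) (z : R * R) (a : C) (b : bool).

Lemma pevalD p q z : peval (p + q) z = peval p z + peval q z.
Proof. exact: mevalD. Qed.

Lemma pevalM p q z : peval (p * q) z = peval p z * peval q z.
Proof. exact: mevalM. Qed.

Lemma pevalZ a p z : peval (a *: p) z = a * peval p z.
Proof. exact: mevalZ. Qed.

Lemma pevalXn p n z : peval (p ^+ n) z = peval p z ^+ n.
Proof. exact: rmorphXn. Qed.

Lemma peval_sum (I : Type) (s : seq I) (F : I -> {poly2 C}) z :
  peval (\sum_(i <- s) F i) z = \sum_(i <- s) peval (F i) z.
Proof. exact: raddf_sum. Qed.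

Lemma pevalC a z : peval (mpolyC 2 a) z = a.
Proof. exact: mevalC. Qed.

Definition var_idx b : 'I_2 := if b then 0 else 1.

Lemma pevalXU b z : peval (mpolyX C (mnm1 (var_idx b))) z = (if b then z.1 else z.2)%:C.
Proof. by rewrite /peval mevalXU; case: b. Qed.

(** Constants and the two variables generate the ring, so properties stable under sums and products
    need only be checked on them. *)
Lemma poly2_ind (P : {poly2 C} -> Prop) :
  (forall a, P (mpolyC 2 a)) -> (forall b, P (mpolyX C (mnm1 (var_idx b)))) ->
  (forall p q, P p -> P q -> P (p + q)) -> (forall p q, P p -> P q -> P (p * q)) ->
  forall p, P p.
Proof.
move=> PC PX PD PM p; rewrite (mpolyE p).
apply: (big_ind P) => [|//|m _]; first by rewrite -mpolyC0.
rewrite -mul_mpolyC; apply: (PM) => //; rewrite mpolyXE_id.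
apply: (big_ind P) => [|//|i _]; first by rewrite -mpolyC1.
elim: (m i) => [|n IH]; first by rewrite expr0 -mpolyC1.
rewrite exprS; apply: PM => //.
case: i {IH} => [[|[|//]] i].
  by rewrite (_ : Ordinal i = var_idx true) //; exact: val_inj.
by rewrite (_ : Ordinal i = var_idx false) //; exact: val_inj.
Qed.

Lemma cclass_peval n U p : open U -> cclass n U (peval p).
Proof.
move=> oU; elim/poly2_ind: p => [a|b|p q Pp Pq|p q Pp Pq].
- by apply: cclass_ext oU _ (cclass_cst n U a) => z _; rewrite pevalC.
- apply: cclass_ext oU (fun z _ => esym (pevalXU b z)) _; apply: cclass_real.
  by case: b; [exact: class_C_fst|exact: class_C_snd].
- by apply: cclass_ext oU _ (cclassD oU Pp Pq) => z _; rewrite pevalD.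
- by apply: cclass_ext oU _ (cclassM oU Pp Pq) => z _; rewrite pevalM.
Qed.

Lemma mnm_subnn n (m : multinom n) : mnm_sub m m = mnm0.
Proof. by apply/mnmP => i; rewrite mnmBE subnn mnm0E. Qed.

(** Both derivatives are additive and obey the Leibniz rule, so agreement on generators suffices.
    Polynomial functions can then be differentiated formally. *)
Lemma partial_peval b p : partial (dir R b) (peval p) = peval (mderiv (var_idx b) p).
Proof.
have CP q : cclass 1 setT (peval q) by apply: cclass_peval; exact: openT.
apply/funext => z; elim/poly2_ind: p => [a|b'|p q Pp Pq|p q Pp Pq].
- rewrite mderivC (_ : peval (mpolyC 2 a) = fun=> a); last by apply/funext => y; rewrite pevalC.
  by rewrite partial_cst -mpolyC0 pevalC.
- rewrite (_ : peval _ = fun z => (if b' then z.1 else z.2)%:C); last first.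
    by apply/funext => y; rewrite pevalXU.
  have dE : 'D_(dir R b) (fun w : R * R => if b' then w.1 else w.2) z = (b == b')%:R.
    have Df : is_derive z (dir R b) (fun w : R * R => if b' then w.1 else w.2) (b == b')%:R.
      apply: is_derive_affine => h; rewrite /dir /ex /ey.
      by case: b; case: b' => /=.
    by rewrite derive_val.
  rewrite /partial /= dE derive_cst mderivX mnm1E.
  have -> : (var_idx b' == var_idx b) = (b == b') by clear dE; case: b; case: b'.
  rewrite pevalZ; case: eqP => [->|_]; last by rewrite mul0r.
  by rewrite mul1r mnm_subnn mpolyX0 -mpolyC1 pevalC.
- have pE : peval (p + q) = (fun y => peval p y + peval q y).
    by apply/funext => y; rewrite pevalD.
  by rewrite pE mderivD pevalD -Pp -Pq; exact: (partialD _ (CP p) (CP q)).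
- have pE : peval (p * q) = (fun y => peval p y * peval q y).
    by apply/funext => y; rewrite pevalM.
  by rewrite pE mderivM pevalD !pevalM -Pp -Pq; exact: (partialM _ (CP p) (CP q)).
Qed.

Lemma dx_peval p : dx (peval p) = peval (mderiv 0 p).
Proof. exact: (partial_peval true). Qed.

Lemma dy_peval p : dy (peval p) = peval (mderiv 1 p).
Proof. exact: (partial_peval false). Qed.

Lemma mderivXn i p n : mderiv i (p ^+ n) = n%:R *: (p ^+ n.-1 * mderiv i p).
Proof.
elim: n => [|n IH]; first by rewrite expr0 scale0r -mpolyC1 mderivC.
rewrite exprS mderivM IH mulrC -scalerAr mulrA.
case: n {IH} => [|n]; first by rewrite scale0r addr0 scale1r.
by rewrite -exprS -[n.+2]add1n natrD scalerDl scale1r.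
Qed.

Lemma mderiv_varB (i j : 'I_2) a :
  mderiv i (mpolyX C (mnm1 j) - mpolyC 2 a) = (i == j)%:R.
Proof.
rewrite mderivB mderivC subr0 mderivX mnm1E eq_sym.
by case: eqP => [->|_]; rewrite ?scale0r // scale1r mnm_subnn mpolyX0.
Qed.

Lemma mderiv_cmonom0 z l m : mderiv 0 (cmonom z l m) = l%:R *: cmonom z l.-1 m.
Proof.
rewrite mderivM !mderivXn !mderiv_varB.
by rewrite !mulr0 scaler0 mulr0 addr0 mulr1 -scalerAl.
Qed.

Lemma mderiv_cmonom1 z l m : mderiv 1 (cmonom z l m) = m%:R *: cmonom z l m.-1.
Proof.
rewrite mderivM !mderivXn !mderiv_varB.
by rewrite !mulr0 scaler0 mul0r add0r mulr1 -scalerAr.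
Qed.

Lemma peval_cmonom z l m : peval (cmonom z l m) z = ((l == 0%N) && (m == 0%N))%:R.
Proof.
have e1 : peval (varX C - mpolyC 2 z.1%:C) z = 0.
  by rewrite -[- _]scaleN1r pevalD pevalZ pevalC (pevalXU true) mulN1r subrr.
have e2 : peval (varY C - mpolyC 2 z.2%:C) z = 0.
  by rewrite -[- _]scaleN1r pevalD pevalZ pevalC (pevalXU false) mulN1r subrr.
by rewrite pevalM !pevalXn e1 e2 !expr0n -natrM mulnb.
Qed.

Lemma iter_dy_peval n p : iter n (@dy R) (peval p) = peval (iter n (mderiv 1) p).
Proof. by elim: n => //= n ->; rewrite dy_peval. Qed.

Lemma iter_dx_peval n p : iter n (@dx R) (peval p) = peval (iter n (mderiv 0) p).
Proof. by elim: n => //= n ->; rewrite dx_peval. Qed.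

Lemma iter_mderiv_cmonom z l m (a b : nat) :
  iter l (mderiv 0) (iter m (mderiv 1) (cmonom z a b)) =
  (a ^_ l * b ^_ m)%:R *: cmonom z (a - l) (b - m).
Proof.
have -> : iter m (mderiv 1) (cmonom z a b) = (b ^_ m)%:R *: cmonom z a (b - m).
  elim: m => [|m IH]; first by rewrite subn0 scale1r.
  by rewrite iterS IH mderivZ mderiv_cmonom1 scalerA -natrM -ffactnSr subnS.
elim: l => [|l IH]; first by rewrite subn0 mul1n.
rewrite iterS IH mderivZ mderiv_cmonom0 scalerA -natrM subnS; congr (_%:R *: _).
by rewrite mulnAC -ffactnSr.
Qed.

(** If [a < l] the falling factorial vanishes; if [a > l] a positive power of $x-x_0$ is left, which
    vanishes at the center; likewise for [b] and [m]. So centered monomials are dual, up to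
    factorials, to derivatives at the center. *)
Lemma derivs_cmonom z l m (a b : nat) :
  iter l (@dx R) (iter m (@dy R) (peval (cmonom z a b))) z =
  (l`! * m`!)%:R * ((a == l) && (b == m))%:R.
Proof.
rewrite iter_dy_peval iter_dx_peval iter_mderiv_cmonom pevalZ peval_cmonom.
case: (ltngtP a l) => [al|al|->]; first by rewrite ffact_small // mul0n mul0r mulr0.
  by rewrite subn_eq0 leqNgt al mulr0 mulr0.
rewrite subnn /=; case: (ltngtP b m) => [bm|bm|->].
- by rewrite (ffact_small bm) muln0 mul0r mulr0.
- by rewrite subn_eq0 leqNgt bm !mulr0.
- by rewrite subnn !ffactnn.
Qed.

Lemma peval_peval_sum (I : Type) (s : seq I) (F : I -> {poly2 C}) :
  peval (\sum_(i <- s) F i) = (fun z => \sum_(i <- s) peval (F i) z).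
Proof. by apply/funext => z; rewrite peval_sum. Qed.

Lemma derivs_sum z l m (I : Type) (s : seq I) (F : I -> {poly2 C}) :
  iter l (@dx R) (iter m (@dy R) (peval (\sum_(i <- s) F i))) z =
  \sum_(i <- s) iter l (@dx R) (iter m (@dy R) (peval (F i))) z.
Proof.
under [RHS]eq_bigr do rewrite Dw_iter.
rewrite Dw_iter peval_peval_sum; apply: (Dw_sum _ openT) => // i.
by apply: cclass_peval; exact: openT.
Qed.

Lemma derivs_scale z l m a p :
  iter l (@dx R) (iter m (@dy R) (peval (a *: p))) z =
  a * iter l (@dx R) (iter m (@dy R) (peval p)) z.
Proof.
rewrite !Dw_iter -(DwZ _ openT) //; last by apply: cclass_peval; exact: openT.
by congr (Dw _ _ _); apply/funext => y; rewrite pevalZ.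
Qed.

(** By duality only the term of degree [l + m] and $x$-exponent [l] survives. The family [c] is
    arbitrary in order to cover both expansions of polynomials and Taylor polynomials. *)
Lemma derivs_expansion z (q : nat) (c : nat -> nat -> C) l m : (l + m <= q)%N ->
  iter l (@dx R) (iter m (@dy R) (peval
    (\sum_(j < q.+1) \sum_(i < j.+1) c j i *: cmonom z i (j - i)))) z =
  (l`! * m`!)%:R * c (l + m)%N l.
Proof.
move=> lmq.
have lt1 : (l + m < q.+1)%N by [].
have lt2 : (l < (l + m).+1)%N by rewrite ltnS leq_addr.
rewrite derivs_sum (bigD1 (Ordinal lt1)) //= [X in _ + X]big1 ?addr0 => [|j jlm].
  rewrite derivs_sum (bigD1 (Ordinal lt2)) //= [X in _ + X]big1 ?addr0 => [|i il].
    by rewrite derivs_scale derivs_cmonom addKn !eqxx mulr1 mulrC.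
  rewrite derivs_scale derivs_cmonom; case: eqP => [e|_]; last by rewrite !mulr0.
  by case/eqP: il; exact: val_inj.
rewrite derivs_sum big1 // => i _; rewrite derivs_scale derivs_cmonom.
case: eqP => [il|_]; last by rewrite !mulr0.
case: eqP => [im|_]; last by rewrite !mulr0.
case/eqP: jlm; apply: val_inj; rewrite /= -il -im subnKC //.
by rewrite -ltnS.
Qed.

(* Each derivative falls on [g] or lowers the degree of the monomial by one, so
   no Leibniz formula is needed. *)
Lemma Dw_vanish z U w g l m : open U -> U z -> cclass (size w) U g ->
  (size w < l + m)%N -> Dw w (fun y => g y * peval (cmonom z l m) y) z = 0.
Proof.
move=> oU Uz; elim: w g l m => [|b w IH] g l m /= Cg lm.
  by rewrite peval_cmonom; case: l m lm => [|l] [|m] //= _; rewrite mulr0.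
pose h y := partial (dir R b) g y * peval (cmonom z l m) y.
pose k y := g y * peval (mderiv (var_idx b) (cmonom z l m)) y.
rewrite (Dw_ext (g := fun y => h y + k y) w oU) //; last first.
  move=> y Uy; rewrite (partialM _ Cg (cclass_peval _ _ oU)) // partial_peval //.
have Cg' : cclass (size w) U g by apply: cclass_le Cg.
have Cdg := cclass_partial b Cg.
rewrite (DwD oU) //; [|exact: cclassM (cclass_peval _ _ oU)..].
rewrite IH // ?add0r; last exact: ltn_trans lm.
(* Here [a] is the exponent brought down by differentiating the monomial. The second disjunct covers
   exponent zero, where the truncated predecessor does not lower the degree but the term
   vanishes. *)
have kE (a : nat) l' m' : (size w < l' + m')%N || (a == 0%N) ->
   mderiv (var_idx b) (cmonom z l m) = a%:R *: cmonom z l' m' -> Dw w k z = 0.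
  move=> lm' e; rewrite (Dw_ext (g := fun y => a%:R * (g y * peval (cmonom z l' m') y)) w oU) //.
    rewrite (DwZ _ oU) //; last exact: cclassM (cclass_peval _ _ oU).
    by case/orP: lm' => [lm'|/eqP ->]; rewrite ?mul0r // IH // mulr0.
  by move=> y _; rewrite /k e pevalZ mulrCA.
case: b {h Cg Cdg} @k kE => k kE.
  apply: (kE l l.-1 m _ (mderiv_cmonom0 _ _ _)).
  by case: l lm {k kE} => [|l] lm; rewrite ?orbT ?orbF.
apply: (kE m l m.-1 _ (mderiv_cmonom1 _ _ _)).
by case: m lm {k kE} => [|m] lm; rewrite ?orbT ?orbF // -ltnS -addnS.
Qed.

End PolynomialFunctions.

(** * Linear algebra and counting *)

Section LinearAlgebra.
Variable K : fieldType.

Lemma linear_Hom (aT rT : vectType K) (f : aT -> rT) :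
  linear f -> exists F : 'Hom(aT, rT), F =1 f.
Proof.
move=> flin; pose fL : {linear aT -> rT} := HB.pack f (GRing.isLinear.Build K aT rT _ f flin).
by exists (linfun fL); exact: lfunE.
Qed.

Lemma free_preim (aT rT : vectType K) (f : 'Hom(aT, rT)) (X : seq aT) :
  free [seq f u | u <- X] -> free X.
Proof.
move=> /(@freeP _ _ _ (map_tuple f (in_tuple X))) fX.
apply/(@freeP _ _ _ (in_tuple X)) => k kX i; apply: fX.
have := congr1 f kX; rewrite linear0 linear_sum; apply: etrans.
by apply: eq_bigr => j _; rewrite linearZ (nth_map 0).
Qed.

(** Rank-nullity bounds the dimension of [lker F] below by that of [Z]; injectivity of [G] on
    [lker F] gives the reverse bound. Equality forces [G] to map the kernel onto [Z]. *)
Lemma lker_coordinates (V W Z : vectType K) (F : 'Hom(V, W)) (G : 'Hom(V, Z)) :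
  (dim W + dim Z <= dim V)%N -> (forall u, F u = 0 -> G u = 0 -> u = 0) ->
  \dim (lker F) = dim Z /\ (G @: lker F)%VS = fullv.
Proof.
move=> dVWZ inj.
have kFG : (lker F :&: lker G = 0)%VS.
  apply/eqP; rewrite -subv0; apply/subvP => u; rewrite memv_cap !memv_ker memv0.
  by move=> /andP[/eqP Fu /eqP Gu]; apply/eqP/inj.
have dG := limg_dim_eq kFG.
have dF := limg_ker_dim F fullv; rewrite capfv dimvf in dF.
have leF : (\dim (F @: fullv) <= dim W)%N by rewrite -(dimvf W) dimvS ?subvf.
have leG : (\dim (G @: lker F) <= dim Z)%N by rewrite -(dimvf Z) dimvS ?subvf.
have geF : (dim Z <= \dim (lker F))%N.
  by rewrite -(leq_add2r (dim W)) addnC (leq_trans dVWZ) // -dF leq_add2l.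
have E : \dim (lker F) = dim Z by apply/eqP; rewrite eqn_leq geF -dG leG.
by split=> //; apply/eqP; rewrite eqEdim subvf dimvf dG E /=.
Qed.

End LinearAlgebra.

(** * Counting the monomials in two variables of bounded degree *)

Section CountMonomials.

Definition bmnm_of (q l m : nat) : bmultinom 2 q.+1 :=
  insubd bm0 (Multinom [tuple l; m]).

Lemma mdeg_pair (l m : nat) : mdeg (Multinom [tuple l; m]) = (l + m)%N.
Proof. by rewrite mdegE !big_ord_recl big_ord0 addn0. Qed.

Lemma mdeg2 (m : multinom 2) : mdeg m = (m 0%R + m 1%R)%N.
Proof.
rewrite mdegE !big_ord_recl big_ord0 addn0; congr (_ + m _)%N; exact: val_inj.
Qed.

Lemma bmnm_of0 q l m : (l + m <= q)%N -> bmnm_of q l m 0 = l.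
Proof. by move=> lm; rewrite /bmnm_of insubdK // [_ \in _]/= unfold_in mdeg_pair. Qed.

Lemma bmnm_of1 q l m : (l + m <= q)%N -> bmnm_of q l m 1 = m.
Proof. by move=> lm; rewrite /bmnm_of insubdK // [_ \in _]/= unfold_in mdeg_pair. Qed.

Lemma bmnm_inj q (m m' : bmultinom 2 q) : m 0 = m' 0 -> m 1 = m' 1 -> m = m'.
Proof.
move=> e0 e1; apply: val_inj; apply/mnmP => i /=.
case: i => [[|[|//]] i].
  by rewrite (_ : Ordinal i = 0) //; exact: val_inj.
by rewrite (_ : Ordinal i = 1) //; exact: val_inj.
Qed.

(** Multiplication by $x^2$ injects the monomials of degree at most [q] into those of degree at most
    [q + 2]. It misses those of $x$-exponent 0 and 1, which number [q + 3] and [q + 2]. *)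
Lemma card_bmultinom2 q :
  (#|{: bmultinom 2 q.+1}| + (2 * q.+2 + 1) <= #|{: bmultinom 2 q.+3}|)%N.
Proof.
pose f (x : bmultinom 2 q.+1 + 'I_(q.+3 + q.+2)) : bmultinom 2 q.+3 :=
  match x with
  | inl m => bmnm_of q.+2 (m 0%R + 2) (m 1%R)
  | inr i => match fintype.split i with
             | inl j => bmnm_of q.+2 0 j
             | inr j => bmnm_of q.+2 1 j
             end
  end.
(* Both exponents are made explicit: the $x$-exponent reveals which of the three families a value
   comes from, and the boolean [q.+3 <= i], read as a number, is that exponent on the last two. *)
have f0 x : f x 0 = match x with inl m => (m 0%R + 2)%N | inr i => (q.+3 <= i)%N : nat end /\
            f x 1 = match x with inl m => m 1 | inr i => (i - (q.+3 <= i)%N * q.+3)%N end.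
  case: x => [m|i] /=.
    have := bmdeg m; rewrite mdeg2 => lm.
    have lm' : (m 0%R + 2 + m 1%R <= q.+2)%N by rewrite addnAC addn2 !ltnS in lm *.
    by rewrite bmnm_of0 ?bmnm_of1.
  case: (fintype.splitP i) => j ->.
    have jq : (0 + j <= q.+2)%N by rewrite add0n -ltnS ltn_ord.
    by rewrite bmnm_of0 // bmnm_of1 // leqNgt ltn_ord mul0n subn0.
  have jq : (1 + j <= q.+2)%N by rewrite add1n ltn_ord.
  by rewrite bmnm_of0 // bmnm_of1 // leq_addr mul1n addKn.
have finj : injective f.
  move=> x y e; have [x0 x1] := f0 x; have [y0 y1] := f0 y.
  move: x0 x1 y0 y1; rewrite e => -> -> .
  case: x y {e} => [m|i] [m'|j].
  - by move=> /eqP; rewrite eqn_add2r => /eqP e0 e1; congr inl; apply: bmnm_inj.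
  - by rewrite addn2; case: (_ <= _)%N.
  - by rewrite addn2; case: (_ <= _)%N.
  - case: (leqP q.+3 i); case: (leqP q.+3 j) => //=.
      move=> jq iq _; rewrite mul1n => /eqP; rewrite eqn_sub2rE // => /eqP e.
      by congr inr; apply: val_inj.
    by move=> _ _ _; rewrite mul0n !subn0 => e; congr inr; apply: val_inj.
have := leq_card f finj; rewrite card_sum card_ord.
by rewrite addSn addnn -mul2n addn1.
Qed.

End CountMonomials.

(** * The Taylor conditions *)

Section TaylorConditions.
Variable R : realType.
Local Notation C := R[i].
Local Open Scope complex_scope.
Implicit Types (z : R * R) (f g : R * R -> C).

Local Notation derivs z l m f := (iter l (@dx R) (iter m (@dy R) f) z).

Lemma fact2_neq0 l m : (l`! * m`!)%:R != 0 :> C.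
Proof. by rewrite pnatr_eq0 muln_eq0 !gtn_eqF ?fact_gt0. Qed.

Lemma size_word l m : size (nseq m false ++ nseq l true) = (l + m)%N.
Proof. by rewrite size_cat !size_nseq addnC. Qed.

Lemma derivsD z U l m f g : open U -> U z -> cclass (l + m) U f -> cclass (l + m) U g ->
  derivs z l m (fun y => f y + g y) = derivs z l m f + derivs z l m g.
Proof.
by move=> oU Uz Cf Cg; rewrite !Dw_iter; apply: DwD oU _ _ Uz; rewrite size_word.
Qed.

Lemma derivsZ z U l m a f : open U -> U z -> cclass (l + m) U f ->
  derivs z l m (fun y => a * f y) = a * derivs z l m f.
Proof.
by move=> oU Uz Cf; rewrite !Dw_iter; apply: DwZ oU _ Uz; rewrite size_word.
Qed.

Lemma derivs_peval z k (p : bpoly C k) l m : (l + m <= k)%N ->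
  derivs z l m (peval p) = (l`! * m`!)%:R * ccoef z p (l + m) l.
Proof.
by move=> lm; rewrite {1}(ccoef_expansion z p); exact: (derivs_expansion _ (ccoef z p) lm).
Qed.

Lemma ccoef_eq0 z k (p : bpoly C k) :
  (forall j i, (i <= j)%N -> (j <= k)%N -> ccoef z p j i = 0) -> p = 0.
Proof.
move=> p0; apply: val_inj; rewrite /= (ccoef_expansion z p).
rewrite big1 // => j _; rewrite big1 // => i _.
by rewrite p0 ?scale0r // -ltnS.
Qed.

(** In the centered expansion of [p], terms of degree below [n] have zero coefficient, and the
    others are killed by [Dw_vanish], their degree exceeding the order [l + m]. *)
Lemma derivs_low z U g k (p : bpoly C k) l m n : open U -> U z -> cclass (l + m) U g ->
  (forall j i, (i <= j)%N -> (j < n)%N -> ccoef z p j i = 0) -> (l + m < n)%N ->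
  derivs z l m (fun y => g y * peval p y) = 0.
Proof.
move=> oU Uz Cg p0 lmn; rewrite -(size_word l m) in Cg lmn.
rewrite Dw_iter; set w := _ ++ _ in Cg lmn *.
have CP q : cclass (size w) U (peval q) by exact: cclass_peval.
have -> : (fun y => g y * peval p y) = (fun y => \sum_(j < k.+1) \sum_(i < j.+1)
    ccoef z p j i * (g y * peval (cmonom z i (j - i)) y)).
  apply/funext => y; rewrite {1}(ccoef_expansion z p) peval_sum mulr_sumr.
  apply: eq_bigr => j _; rewrite peval_sum mulr_sumr; apply: eq_bigr => i _.
  by rewrite pevalZ mulrCA.
have CM j i : cclass (size w) U (fun y => ccoef z p j i * (g y * peval (cmonom z i (j - i)) y)).
  by apply: (cclassM oU); [exact: cclass_cst|exact: cclassM].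
rewrite (Dw_sum _ oU) // => [|j]; last by apply: (cclass_sum _ oU) => i; exact: CM.
rewrite big1 // => j _; rewrite (Dw_sum _ oU) //.
rewrite big1 // => i _; rewrite (DwZ _ oU) //; last exact: cclassM.
have ij : (i <= j)%N by rewrite -ltnS.
case: (ltnP j n) => [jn|nj]; first by rewrite p0 ?mul0r.
by rewrite (Dw_vanish oU Uz Cg) ?mulr0 // subnKC // (leq_trans lmn).
Qed.

(** Differentiating the Taylor polynomial at its center returns the derivatives of [f], as the
    factorials cancel. *)
Lemma taylor_eq0 q f z :
  taylor q f z = 0 <-> forall l m, (l + m <= q)%N -> derivs z l m f = 0.
Proof.
split=> [T0 l m lm|D0].
  have := derivs_expansion z
    (fun j i => derivs z i (j - i) f / (i`! * (j - i)`!)%:R) lm.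
  rewrite -/(taylor q f z) T0 addKn mulrC divfK ?fact2_neq0 // => <-.
  rewrite -(scale0r 0) derivs_scale mul0r //.
rewrite /taylor big1 // => k _; rewrite big1 // => l _.
by rewrite D0 ?mul0r ?scale0r // subnKC -ltnS.
Qed.

(** Indexing by the monomials of degree at most [q] makes the number of scalar Taylor conditions
    comparable with the dimensions of the polynomial spaces. *)
Definition derivs_row q z f : 'rV[C]_#|{: bmultinom 2 q.+1}| :=
  \row_i derivs z ((enum_val i : bmultinom 2 q.+1) 0) ((enum_val i : bmultinom 2 q.+1) 1) f.

Lemma derivs_row_eq0 q z f : derivs_row q z f = 0 <-> taylor q f z = 0.
Proof.
rewrite taylor_eq0; split=> [D0 l m lm|D0].
  have /rowP/(_ (enum_rank (bmnm_of q l m))) := D0.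
  by rewrite !mxE enum_rankK bmnm_of0 // bmnm_of1.
apply/rowP => i; rewrite !mxE; apply: D0; rewrite -mdeg2 -ltnS; exact: bmdeg.
Qed.

Lemma derivs_row_linear q z U a f g : open U -> U z -> cclass q U f -> cclass q U g ->
  derivs_row q z (fun y => a * f y + g y) = a *: derivs_row q z f + derivs_row q z g.
Proof.
move=> oU Uz Cf Cg; apply/rowP => i; rewrite !mxE.
set m : bmultinom 2 q.+1 := enum_val i.
have mq : (m 0%R + m 1%R <= q)%N by rewrite -mdeg2 -ltnS; exact: bmdeg.
have Cf' := cclass_le mq Cf; have Cg' := cclass_le mq Cg.
rewrite (derivsD oU Uz _ Cg') ?(derivsZ _ oU Uz Cf') //.
exact: cclassM (cclass_cst _ _ a) Cf'.
Qed.

(** The extra $x$-derivative must cross the $y$-derivatives; this is done on formal derivatives,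
    which commute. *)
Lemma derivs_mderiv0 z l m (p : {poly2 C}) :
  derivs z l m (peval (mderiv 0 p)) = derivs z l.+1 m (peval p).
Proof.
have comm : iter m (mderiv 1) (mderiv 0 p) = mderiv 0 (iter m (mderiv 1) p).
  by elim: m => //= m ->; rewrite mderiv_comm.
by rewrite [in RHS]iterSr !iter_dy_peval comm dx_peval.
Qed.

Lemma derivs_mderiv1 z l m (p : {poly2 C}) :
  derivs z l m (peval (mderiv 1 p)) = derivs z l m.+1 (peval p).
Proof. by rewrite [in RHS]iterSr dy_peval. Qed.

(** * The three operators expressed through centered coefficients *)

Section Operators.
Variables (omega rho : R) (d : nat).
Implicit Types (p : bpoly C d) (v : bpoly C (d - 1)).

Definition impedance : C := 'i * (omega * rho)%:C.

Lemma impedance_neq0 : omega != 0 -> 0 < rho -> impedance != 0.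
Proof.
move=> om0 rh0; rewrite mulf_neq0 ?neq0Ci //.
by rewrite (inj_eq (@complexI R)) mulf_neq0 // lt0r_neq0.
Qed.

(** Common polynomial form of the first two operators, with [v] the velocity component in direction
    [i]. *)
Definition momentum (i : 'I_2) (p v : {poly2 C}) : {poly2 C} := mderiv i p - impedance *: v.

Lemma S1E (p vx : {poly2 C}) vy :
  S1 omega rho (peval p) (peval vx) vy = peval (momentum 0 p vx).
Proof.
apply/funext => z; rewrite /S1 dx_peval /momentum -scaleNr pevalD pevalZ addrC //.
Qed.

Lemma S2E (p vy : {poly2 C}) vx :
  S2 omega rho (peval p) vx (peval vy) = peval (momentum 1 p vy).
Proof.
apply/funext => z; rewrite /S2 dy_peval /momentum -scaleNr pevalD pevalZ addrC //.
Qed.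

Lemma momentum_linear i a (p p' v v' : {poly2 C}) :
  momentum i (a *: p + p') (a *: v + v') = a *: momentum i p v + momentum i p' v'.
Proof.
rewrite /momentum mderivD mderivZ scalerDr scalerBr !scalerA [impedance * a]mulrC -!scalerA.
by rewrite opprD addrACA.
Qed.

Lemma derivs_momentum z i l m p v :
  derivs z l m (peval (momentum i p v)) =
  derivs z l m (peval (mderiv i p)) - impedance * derivs z l m (peval v).
Proof.
rewrite -mulNr -derivs_scale -(derivsD openT) //; try exact: (cclass_peval _ _ openT).
by congr (iter _ _ (iter _ _ _) _); apply/funext => y; rewrite -pevalD scaleNr.
Qed.

Lemma mulr_common_factor (A : comPzRingType) (F a b x y : A) :
  a * F * x - b * (F * y) = F * (a * x - b * y).
Proof. by rewrite mulrBr [F * (b * y)]mulrCA [F * (a * x)]mulrCA -mulrA. Qed.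

(** Since $(l+1)! = (l+1)\,l!$, both terms share the factor $l!\,m!$. The bound keeps the indices
    within degree [d] for [p] and [d - 1] for [v]. *)
Lemma momentum0_ccoef z l m p v : (l + m < d)%N ->
  derivs z l m (peval (momentum 0 p v)) =
  (l`! * m`!)%:R * (l.+1%:R * ccoef z p (l + m).+1 l.+1 - impedance * ccoef z v (l + m) l).
Proof.
move=> lmd; rewrite derivs_momentum derivs_mderiv0 !derivs_peval ?addSn //; last first.
  by rewrite leq_subRL ?add1n // (leq_ltn_trans _ lmd).
by rewrite factS -mulnA natrM mulr_common_factor.
Qed.

Lemma momentum1_ccoef z l m p v : (l + m < d)%N ->
  derivs z l m (peval (momentum 1 p v)) =
  (l`! * m`!)%:R * (m.+1%:R * ccoef z p (l + m).+1 l - impedance * ccoef z v (l + m) l).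
Proof.
move=> lmd; rewrite derivs_momentum derivs_mderiv1 !derivs_peval ?addnS //; last first.
  by rewrite leq_subRL ?add1n // (leq_ltn_trans _ lmd).
by rewrite factS mulnCA natrM mulr_common_factor.
Qed.

Definition stiffness (c : R * R -> R) z : C := - ('i * (omega / (rho * c z ^+ 2))%:C).

Lemma S3E c f (vx vy : {poly2 C}) :
  S3 omega rho c f (peval vx) (peval vy) =
  (fun z => stiffness c z * f z + peval (mderiv 0 vx + mderiv 1 vy) z).
Proof. by apply/funext => z; rewrite /S3 dx_peval dy_peval pevalD addrA. Qed.

(** The product with [g] is kept whole, to be treated by [derivs_low]; the divergence, of one order
    more, reads off velocity coefficients of degree [l + m + 1]. *)
Lemma derivs_continuity z U g p (vx vy : bpoly C (d - 1)) l m :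
  open U -> U z -> cclass (l + m) U g -> ((l + m).+1 <= d - 1)%N ->
  derivs z l m (fun y => g y * peval p y + peval (mderiv 0 vx + mderiv 1 vy) y) =
  derivs z l m (fun y => g y * peval p y) +
  (l`! * m`!)%:R * (l.+1%:R * ccoef z vx (l + m).+1 l.+1 +
                    m.+1%:R * ccoef z vy (l + m).+1 l).
Proof.
move=> oU Uz Cg lmd; have CP q : cclass (l + m) U (peval q) by exact: cclass_peval.
rewrite (derivsD oU Uz (cclassM oU Cg (CP _)) (CP _)); congr (_ + _).
rewrite (_ : peval (_ + _) = fun y => peval (mderiv 0 vx) y + peval (mderiv 1 vy) y);
  last by apply/funext => y; rewrite pevalD.
rewrite (derivsD oU Uz (CP _) (CP _)) derivs_mderiv0 derivs_mderiv1.
have lx : (l.+1 + m <= d - 1)%N by rewrite addSn.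
have ly : (l + m.+1 <= d - 1)%N by rewrite addnS.
rewrite (derivs_peval z vx lx) (derivs_peval z vy ly) addSn addnS.
have -> : (l.+1`! * m`!)%:R = l.+1%:R * (l`! * m`!)%:R :> C.
  by rewrite factS -mulnA natrM.
have -> : (l`! * m.+1`!)%:R = m.+1%:R * (l`! * m`!)%:R :> C.
  by rewrite factS mulnCA natrM.
set F := (l`! * m`!)%:R.
by rewrite mulrDr -!mulrA; congr (_ + _); rewrite mulrCA.
Qed.

(** By continuity [c] stays nonzero near [z]; on a smaller open set $1/c$ inherits the class of [c],
    and products do the rest. *)
Lemma stiffness_near q c z : class_C_near q c z -> c z != 0 ->
  exists U : set (R * R), [/\ open U, U z & cclass q U (stiffness c)].
Proof.
move=> [V [oV Vz] Cc] cz.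
have cnz : \forall y \near z, c y != 0.
  exact: (cvgr_neq0 _ (class_C_cont Cc Vz)).
have : nbhs z (V `&` [set y | c y != 0]).
  by apply: filterI => //; apply: open_nbhs_nbhs.
rewrite nbhsE => -[U [oU Uz] UV]; exists U; split=> //.
have CcU : class_C q U c by apply: class_C_sub Cc => y /UV [].
have cU y : U y -> c y != 0 by move=> /UV [].
have CV := class_CV oU cU CcU.
have CR := class_CM oU (class_C_cst q U (omega / rho)) (class_CM oU CV CV).
have := cclassM oU (cclass_cst q U (- 'i)) (cclass_real CR).
apply: cclass_ext => // y _; rewrite /stiffness mulNr; congr (- (_ * _%:C)).
rewrite -[LHS]/(omega / rho * ((c y)^-1 * (c y)^-1)) expr2 !invfM.
by rewrite -mulrA.
Qed.

End Operators.

End TaylorConditions.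

(** * Linearity and vanishing of the two coefficient lists *)

Section Coefficients.
Variables (R : realType) (z : R * R).
Local Notation C := R[i].

Lemma ccoef_linear a (p q : {poly2 C}) k l :
  ccoef z (a *: p + q) k l = a * ccoef z p k l + ccoef z q k l.
Proof. by rewrite /ccoef linearP mcoeffD mcoeffZ. Qed.

Lemma nth_pairs_linear (a : C) (f g f1 g1 f2 g2 : nat -> C) s i :
  (forall k, f k = a * f1 k + f2 k) -> (forall k, g k = a * g1 k + g2 k) ->
  (flatten [seq [:: f k; g k] | k <- s])`_i =
  a * (flatten [seq [:: f1 k; g1 k] | k <- s])`_i +
      (flatten [seq [:: f2 k; g2 k] | k <- s])`_i.
Proof.
move=> fE gE; elim: s i => [|k s IH] [|[|i]] //=; rewrite ?nth_nil ?mulr0 ?addr0 //.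
Qed.

Lemma coefs_linear L d a (u v : triple R d) i :
  (coefs L z (a *: u + v))`_i = a * (coefs L z u)`_i + (coefs L z v)`_i.
Proof.
case: u v => [[p vx] vy] [[p' vx'] vy'].
have lin j (r r' : bpoly C j) k l : ccoef z (a *: r + r')%R k l =
    a * ccoef z r k l + ccoef z r' k l by exact: ccoef_linear.
rewrite -[a *: _ + _]/(a *: p + p', a *: vx + vx', a *: vy + vy').
move: (a *: p + p') (lin _ p p') (a *: vx + vx') (lin _ vx vx') (a *: vy + vy') (lin _ vy vy').
move=> P PE VX VXE VY VYE.
case: L => /=; last by case: i => [|i] //=; apply: nth_pairs_linear.
by case: i => [|[|[|i]]] //=; apply: nth_pairs_linear.
Qed.

Lemma coef_vec_linear L d : linear (@coef_vec R L d z).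
Proof. by move=> a u v; apply/rowP => i; rewrite [LHS]mxE coefs_linear 4!mxE. Qed.

Lemma mem_pairs (T : eqType) (f g : nat -> T) s k : k \in s ->
  f k \in flatten [seq [:: f k; g k] | k <- s] /\
  g k \in flatten [seq [:: f k; g k] | k <- s].
Proof.
move=> ks; split; apply/flattenP; exists [:: f k; g k];
  by rewrite ?inE ?eqxx ?orbT //; apply/mapP; exists k.
Qed.

Lemma coef_vec_eq0 L d (u : triple R d) : (0 < d)%N -> coef_vec L z u = 0 ->
  forall x, x \in coefs L z u -> x = 0.
Proof.
move=> d0 K0 x /(nthP 0)[i ilt <-]; rewrite size_coefs // in ilt.
by have /rowP/(_ (Ordinal ilt)) := K0; rewrite !mxE.
Qed.

Lemma mem_cons3 (T : eqType) (a b c : T) s :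
  [/\ a \in [:: a, b, c & s], b \in [:: a, b, c & s], c \in [:: a, b, c & s] &
      {subset s <= [:: a, b, c & s]}].
Proof. by split=> [|||x xs]; rewrite !inE ?eqxx ?xs ?orbT. Qed.

Lemma coef_vecA_eq0 d (p : bpoly C d) (vx vy : bpoly C (d - 1)) :
  (0 < d)%N -> coef_vec ListA z ((p, vx, vy) : triple R d) = 0 ->
  [/\ ccoef z p 0 0 = 0, ccoef z vx 0 0 = 0, ccoef z vy 0 0 = 0 &
      forall k, (0 < k < d)%N -> ccoef z vy k 0 = 0 /\ ccoef z vy k 1 = 0].
Proof.
move=> d0 /(coef_vec_eq0 d0) K0.
have [m1 m2 m3 ms] := mem_cons3 (ccoef z p 0 0) (ccoef z vx 0 0) (ccoef z vy 0 0)
  (flatten [seq [:: ccoef z vy k 0; ccoef z vy k 1] | k <- iota 1 (d - 1)]).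
split=> [|||k kd]; [exact: K0 m1|exact: K0 m2|exact: K0 m3|].
have ks : k \in iota 1 (d - 1) by rewrite mem_iota add1n subn1 prednK.
have [f1 f2] := mem_pairs (ccoef z vy ^~ 0%N) (ccoef z vy ^~ 1%N) ks.
by split; [exact: K0 (ms _ f1)|exact: K0 (ms _ f2)].
Qed.

Lemma coef_vecB_eq0 d (p : bpoly C d) (vx vy : bpoly C (d - 1)) :
  (0 < d)%N -> coef_vec ListB z ((p, vx, vy) : triple R d) = 0 ->
  ccoef z p 0 0 = 0 /\
  forall k, (0 < k <= d)%N -> ccoef z p k 0 = 0 /\ ccoef z p k 1 = 0.
Proof.
move=> d0 /(coef_vec_eq0 d0) K0; split=> [|k kd]; first by apply: K0; exact: mem_head.
have ks : k \in iota 1 d by rewrite mem_iota add1n ltnS.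
have [f1 f2] := mem_pairs (ccoef z p ^~ 0%N) (ccoef z p ^~ 1%N) ks.
by split; apply: K0; rewrite in_cons ?f1 ?f2 orbT.
Qed.

End Coefficients.

(** This is the shape of a momentum equation: it makes a pressure and a velocity coefficient vanish
    together. *)
Lemma eq0_of_scaled_eq (F : idomainType) (e a b x y : F) :
  e != 0 -> a != 0 -> b != 0 -> e * (a * x - b * y) = 0 -> (x == 0) = (y == 0).
Proof.
move=> e0 a0 b0 /eqP; rewrite mulf_eq0 (negbTE e0) subr_eq0 => /eqP axby.
by rewrite -[x == 0]orFb -(negbTE a0) -mulf_eq0 axby mulf_eq0 (negbTE b0).
Qed.

Lemma eq0_of_scaled (F : idomainType) (e a x : F) :
  e != 0 -> a != 0 -> e * (a * x) = 0 -> x = 0.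
Proof.
by move=> e0 a0 /eqP; rewrite !mulf_eq0 (negbTE e0) (negbTE a0) => /eqP.
Qed.

Definition rows_space (R : realType) (d : nat) : vectType R[i] :=
  ('rV[R[i]]_#|{: bmultinom 2 (d - 1).+1}| * 'rV[R[i]]_#|{: bmultinom 2 (d - 1).+1}| *
   'rV[R[i]]_#|{: bmultinom 2 (d - 2).+1}|)%type.

(** The two velocity spaces match the first two Taylor conditions in dimension. What remains
    compares degree [d] with degree [d - 2]. *)
Lemma dim_rows_space (R : realType) d : (2 <= d)%N ->
  (dim (rows_space R d) + (2 * d + 1) <= dim (triple R d))%N.
Proof.
move=> hd.
have -> : dim (rows_space R d) = (#|{: bmultinom 2 (d - 1).+1}| +
    #|{: bmultinom 2 (d - 1).+1}| + #|{: bmultinom 2 (d - 2).+1}|)%N.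
  rewrite -[LHS]/(dim 'rV[R[i]]_#|{: bmultinom 2 (d - 1).+1}| +
    dim 'rV[R[i]]_#|{: bmultinom 2 (d - 1).+1}| +
    dim 'rV[R[i]]_#|{: bmultinom 2 (d - 2).+1}|)%N.
  by rewrite !dim_matrix !mul1r.
rewrite -[dim (triple R d)]/(#|{: bmultinom 2 d.+1}| + #|{: bmultinom 2 (d - 1).+1}| +
   #|{: bmultinom 2 (d - 1).+1}|)%N.
rewrite -addnA addnC -[leqRHS]addnA leq_add2r.
have dE : (d - 2).+2 = d by rewrite -addn2 subnK.
by have := card_bmultinom2 (d - 2); rewrite dE.
Qed.

(** * Injectivity of the coefficient map and linearity of the Taylor conditions *)

Section QuasiTrefftzSpace.
Variables (R : realType) (z : R * R) (d : nat) (omega rho : R) (c : R * R -> R).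
Variable U : set (R * R).
Hypotheses (hd : (2 <= d)%N) (homega : omega != 0) (hrho : 0 < rho).
Hypotheses (oU : open U) (Uz : U z) (Ch : cclass (d - 2) U (stiffness omega rho c)).
Local Notation C := R[i].

Lemma d_gt0 : (0 < d)%N. Proof. exact: ltnW. Qed.

Lemma quasi_trefftz_inj L (u : triple R d) :
  quasi_trefftz omega rho c z u -> coef_vec L z u = 0 -> u = 0.
Proof.
case: u => [[p vx] vy] [T1 T2 T3] K0.
have k0 : impedance omega rho != 0 by exact: impedance_neq0.
have E1 l m : (l + m < d)%N ->
    (ccoef z p (l + m).+1 l.+1 == 0) = (ccoef z vx (l + m) l == 0).
  move=> lm; rewrite S1E in T1.
  have lm' : (l + m <= d - 1)%N by rewrite subn1 -ltnS prednK ?d_gt0.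
  have e := (taylor_eq0 _ _ _).1 T1 l m lm'.
  rewrite (momentum0_ccoef _ _ _ _ _ lm) in e.
  by apply: eq0_of_scaled_eq (fact2_neq0 _ _ _) _ k0 e; rewrite pnatr_eq0.
have E2 l m : (l + m < d)%N ->
    (ccoef z p (l + m).+1 l == 0) = (ccoef z vy (l + m) l == 0).
  move=> lm; rewrite S2E in T2.
  have lm' : (l + m <= d - 1)%N by rewrite subn1 -ltnS prednK ?d_gt0.
  have e := (taylor_eq0 _ _ _).1 T2 l m lm'.
  rewrite (momentum1_ccoef _ _ _ _ _ lm) in e.
  by apply: eq0_of_scaled_eq (fact2_neq0 _ _ _) _ k0 e; rewrite pnatr_eq0.
(* Once the pressure vanishes up to degree [l + m], its product with the variable coefficient drops
   out, and only the two divergence terms are left. *)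
have E3 l m : (l + m <= d - 2)%N ->
    (forall j i, (i <= j)%N -> (j < (l + m).+1)%N -> ccoef z p j i = 0) ->
    ccoef z vy (l + m).+1 l = 0 -> ccoef z vx (l + m).+1 l.+1 = 0.
  move=> lm p0 vy0; rewrite S3E in T3.
  have lmd : ((l + m).+1 <= d - 1)%N.
    by rewrite subn1 -ltnS prednK ?d_gt0 // -addn2 addnC -leq_subRL.
  have Ch' := cclass_le lm Ch.
  have e := (taylor_eq0 _ _ _).1 T3 l m lm.
  rewrite (derivs_continuity _ _ _ oU Uz Ch' lmd) in e.
  rewrite (derivs_low oU Uz Ch' p0 (ltnSn _)) add0r vy0 mulr0 addr0 in e.
  by apply: eq0_of_scaled (fact2_neq0 _ _ _) _ e; rewrite pnatr_eq0.
(* For list (A), $\lambda^{n+1}_0$ and $\lambda^{n+1}_1$ are tied to $\eta^n_0$ and $\eta^n_1$,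
   except that $\lambda^1_1$ is tied to $\mu^0_0$. *)
have B n : (n < d)%N -> ccoef z p n.+1 0 = 0 /\ ccoef z p n.+1 1 = 0.
  move=> nd; case: L K0 => K0; last by apply: (coef_vecB_eq0 d_gt0 K0).2.
  have [_ vx0 vy0 vy01] := coef_vecA_eq0 d_gt0 K0.
  case: n nd => [|n] nd.
    by split; apply/eqP; [rewrite (E2 0%N 0%N nd) vy0|rewrite (E1 0%N 0%N nd) vx0].
  have [vyn0 vyn1] := vy01 n.+1 nd.
  by split; apply/eqP; [rewrite (E2 0%N n.+1 nd) vyn0|rewrite (E2 1%N n nd) vyn1].
have p00 : ccoef z p 0 0 = 0.
  by case: L K0 => K0; [case: (coef_vecA_eq0 d_gt0 K0)|case: (coef_vecB_eq0 d_gt0 K0)].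
have p0 n : (n <= d)%N -> forall l, (l <= n)%N -> ccoef z p n l = 0.
  elim/ltn_ind: n => n IHn nd; elim/ltn_ind => l IHl ln.
  case: l IHl ln => [|[|l]] IHl ln.
  - by case: n nd {ln IHn IHl} => [|n] nd; [exact: p00|exact: (B n nd).1].
  - by case: n nd ln {IHn IHl} => // n nd _; exact: (B n nd).2.
  (* With [m] the exponent of $y$, the third condition is used at index [(l, m)], of order
     [n - 2]. *)
  pose m := (n - l.+2)%N; have nE : n = (l + m).+2 by rewrite -!addSn subnKC.
  rewrite {}nE in nd ln IHn IHl *; move: m nd ln IHn IHl => m nd ln IHn IHl.
  (* The coefficient of $x^{l+2}y^m$ in the pressure passes to [vx] by [E1], to [vy] by [E3], and
     back by [E2] to that of $x^l y^{m+2}$, of the same degree but smaller $x$-exponent. *)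
  apply/eqP; rewrite -!addSn (E1 l.+1 m) // addSn; apply/eqP; apply: E3.
  - by rewrite leq_subRL // add2n.
  - by move=> j i ij jlm; apply: IHn => //; [apply: ltn_trans jlm _|apply: leq_trans nd; apply: leqW; apply: leqW].
  - apply/eqP; rewrite -addnS -E2 addnS //; apply/eqP; apply: IHl => //.
    by apply: leqW; apply: leqW; apply: leq_addr.
congr (_, _, _); apply: (ccoef_eq0 (z := z)) => j i ij jd.
- exact: p0.
- have jd' : (j < d)%N by rewrite -(prednK d_gt0) ltnS -subn1.
  by apply/eqP; rewrite -(subnKC ij) -E1 subnKC //; apply/eqP; apply: p0.
- have jd' : (j < d)%N by rewrite -(prednK d_gt0) ltnS -subn1.
  by apply/eqP; rewrite -(subnKC ij) -E2 subnKC //; apply/eqP; apply: p0 => //; apply: leqW.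
Qed.

Definition trefftz_rows (u : triple R d) : rows_space R d :=
  let: (p, vx, vy) := u in
  (derivs_row (d - 1) z (S1 omega rho (peval p) (peval vx) (peval vy)),
   derivs_row (d - 1) z (S2 omega rho (peval p) (peval vx) (peval vy)),
   derivs_row (d - 2) z (S3 omega rho c (peval p) (peval vx) (peval vy))).

Lemma trefftz_rows_eq0 u : trefftz_rows u = 0 <-> quasi_trefftz omega rho c z u.
Proof.
case: u => [[p vx] vy]; split.
  by move=> [] /derivs_row_eq0 T1 /derivs_row_eq0 T2 /derivs_row_eq0 T3; split.
case=> T1 T2 T3.
have D1 := proj2 (derivs_row_eq0 _ _ _) T1.
have D2 := proj2 (derivs_row_eq0 _ _ _) T2.
have D3 := proj2 (derivs_row_eq0 _ _ _) T3.
exact: (f_equal2 pair (f_equal2 pair D1 D2) D3).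
Qed.

(** Derivatives are additive on sufficiently regular functions: the first two rows involve
    polynomials, and the class $C^{d-2}$ of [stiffness] matches the order of the third. *)
Lemma trefftz_rows_linear : linear trefftz_rows.
Proof.
move=> a [[p vx] vy] [[p' vx'] vy'].
have CP q n : cclass n U (peval q) by exact: cclass_peval.
have plin (q q' : {poly2 C}) : peval (a *: q + q') = (fun y => a * peval q y + peval q' y).
  by apply/funext => y; rewrite pevalD pevalZ.
have divE (w w' v v' : {poly2 C}) : mderiv 0 (a *: w + w') + mderiv 1 (a *: v + v') =
    a *: (mderiv 0 w + mderiv 1 v) + (mderiv 0 w' + mderiv 1 v').
  by rewrite !mderivD !mderivZ scalerDr addrACA.
have bE j (q q' : bpoly C j) : bpoly_val (a *: q + q') = a *: bpoly_val q + bpoly_val q'.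
  by [].
rewrite -[a *: _ + _]/(a *: p + p', a *: vx + vx', a *: vy + vy').
rewrite /trefftz_rows !bE !S1E !S2E !S3E !momentum_linear !divE !plin.
have CS q (w w' : {poly2 C}) : cclass (d - 2) U (fun y =>
    stiffness omega rho c y * peval q y + peval (mderiv 0 w + mderiv 1 w') y).
  exact: cclassD oU (cclassM oU Ch (CP _ _)) (CP _ _).
rewrite !(derivs_row_linear a oU Uz (CP _ _) (CP _ _)).
rewrite [X in (_, _, X) = _](_ : _ = a *: derivs_row (d - 2) z (fun y =>
    stiffness omega rho c y * peval p y + peval (mderiv 0 vx + mderiv 1 vy) y) +
  derivs_row (d - 2) z (fun y =>
    stiffness omega rho c y * peval p' y + peval (mderiv 0 vx' + mderiv 1 vy') y)) //.
rewrite -(derivs_row_linear a oU Uz (CS _ _ _) (CS _ _ _)).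
congr derivs_row; apply/funext => y.
move: (stiffness _ _ _ _) (peval _ _) (peval _ _) (peval _ _) (peval _ _).
by move=> *; ring.
Qed.

End QuasiTrefftzSpace.

(** * The space as a kernel, with its coordinates and its dimension *)

Theorem mainTheorem1 (R : realType) (x0 : R * R) (d : nat) (omega rho : R)
    (c : R * R -> R) (hd : (2 <= d)%N) (homega : omega != 0) (hrho : 0 < rho)
    (hc : class_C_near (d - 2) c x0) (hc0 : c x0 != 0) :
  exists S : {vspace triple R d},
    (forall u : triple R d, u \in S <-> quasi_trefftz omega rho c x0 u) /\
    (forall L : coef_list,
       (forall a : 'rV[R[i]]_(2 * d + 1),
          exists2 u : triple R d, u \in S & coef_vec L x0 u = a) /\
       (forall X : (2 * d + 1).-tuple (triple R d),
          (forall u, u \in X -> u \in S) ->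
          basis_of fullv [seq coef_vec L x0 u | u <- X] ->
          free X)) /\
    \dim S = (2 * d + 1)%N /\
    (forall (L : coef_list) (X : (2 * d + 1).-tuple (triple R d)),
       (forall u, u \in X -> u \in S) ->
       basis_of fullv [seq coef_vec L x0 u | u <- X] ->
       basis_of S X).
Proof.
have [U [oU Uz Ch]] := stiffness_near omega rho hc hc0.
have [F FE] := linear_Hom (trefftz_rows_linear oU Uz Ch).
have memS u : u \in lker F <-> quasi_trefftz omega rho c x0 u.
  by rewrite memv_ker FE -trefftz_rows_eq0; split=> /eqP.
exists (lker F).
(* Surjectivity of [G] on the kernel is statement (i), and it comes together with the dimension. *)
have kS L : exists2 G : 'Hom(triple R d, 'rV[R[i]]_(2 * d + 1)), G =1 coef_vec L x0 &
    \dim (lker F) = (2 * d + 1)%N /\ (G @: lker F)%VS = fullv.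
  have [G GE] := linear_Hom (coef_vec_linear x0 L (d := d)); exists G => //.
  have dimE : dim 'rV[R[i]]_(2 * d + 1) = (2 * d + 1)%N by rewrite dim_matrix mul1r.
  rewrite -[X in _ = X /\ _]dimE.
  apply: lker_coordinates => [|u Fu Gu]; first by rewrite dimE dim_rows_space.
  apply: (quasi_trefftz_inj hd homega hrho oU Uz Ch (L := L)); last by rewrite -GE.
  by apply/memS; rewrite memv_ker Fu.
have freeX L (X : seq (triple R d)) :
    basis_of fullv [seq coef_vec L x0 u | u <- X] -> free X.
  have [G GE _] := kS L; move=> /basis_free fX; apply: (@free_preim _ _ _ G).
  by rewrite (eq_map GE).
split; first exact: memS.
split=> [L|].
  split=> [a|X _]; last exact: freeX.
  have [G GE [_ Gf]] := kS L; have : a \in (G @: lker F)%VS by rewrite Gf memvf.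
  by move=> /memv_imgP[u uS ->]; exists u => //; rewrite GE.
(* The dimension is the same whichever list computes it. A free family of that size inside the space
   is then a basis. *)
have [G _ [dS _]] := kS ListA; split=> [//|L X XS bX].
rewrite basisEfree (freeX L) //= dS size_tuple leqnn andbT.
by apply/span_subvP.
Qed.
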